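(* Let $M\subseteq\mathbb{Z}^q_{\geq0}$ be an affine monoid. Then $|V_m(M)|=m^{\operatorname{rank}(M)}$ for some $m\in\mathbb{Z}_{>1}$ if and only if $M\cong\mathbb{Z}^t_{\geq0}$ (as monoids) for some $t$.
   Context: An affine monoid $M\subseteq\mathbb{Z}^q_{\geq 0}$ ($q$ a positive integer) is a finitely generated submonoid of $\mathbb{Z}^q$ contained in $\mathbb{Z}^q_{\geq0}$. $\mathbb{Z}M$ is the group generated by $M$, and $\operatorname{rank}(M)=\dim_{\mathbb{Q}}(\mathbb{Q}\otimes_{\mathbb{Z}}\mathbb{Z}M)$. For an integer $m>1$, $\frac1mM=\{\gamma/m:\gamma\in M\}$ and $$V_m(M)=\left\{\alpha\in\tfrac1mM \;\middle|\; \left(\tfrac1mM-\alpha\right)\cap\mathbb{Z}M\subseteq M\right\}.$$ *)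

(* Defs.v *)
From HB Require Import structures.
From mathcomp Require Import all_boot all_order all_algebra.
From mathcomp Require Import all_classical.

Set Implicit Arguments.
Unset Strict Implicit.
Unset Printing Implicit Defensive.

Import GRing.Theory.
Local Open Scope classical_set_scope.
Local Open Scope ring_scope.

Definition submonoid (A : nmodType) (S : set A) : Prop :=
  S 0 /\ forall x y, S x -> S y -> S (x + y).

Definition subgroup (A : zmodType) (S : set A) : Prop :=
  S 0 /\ forall x y, S x -> S y -> S (x - y).

Definition orthant (n : nat) : set 'rV[int]_n :=
  [set x : 'rV[int]_n | forall i, 0 <= x 0 i].

Definition affine_monoid (q : nat) (M : set 'rV[int]_q) : Prop :=
  [/\ submonoid M,
      exists s : seq 'rV[int]_q, M = smallest (@submonoid _) [set` s]
    & M `<=` @orthant q].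

Definition grp (q : nat) (M : set 'rV[int]_q) : set 'rV[int]_q :=
  smallest (@subgroup _) M.

(* A map out of [rat * G] is encoded as a map defined on the whole ambient
   group whose values outside [G] are irrelevant. *)
Definition biadditive_on (A : zmodType) (G : set A) (W : zmodType)
    (b : rat -> A -> W) : Prop :=
  (forall r s x, G x -> b (r + s) x = b r x + b s x) /\
  (forall r x y, G x -> G y -> b r (x + y) = b r x + b r y).

(* [T], with pure tensors [t r x], is the rational vector space Q (x)_Z G:
   [t] is the universal Z-bilinear map out of [rat * G], and scalars act on
   the left factor. *)
Definition is_rat_tensor (A : zmodType) (G : set A) (T : vectType rat)
    (t : rat -> A -> T) : Prop :=
  [/\ biadditive_on G t,
      forall r s x, G x -> t (r * s) x = r *: t s x
    & forall (W : zmodType) (b : rat -> A -> W), biadditive_on G b ->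
        (exists f : {additive T -> W}, forall r x, G x -> f (t r x) = b r x) /\
        (forall f g : {additive T -> W},
           (forall r x, G x -> f (t r x) = b r x) ->
           (forall r x, G x -> g (t r x) = b r x) -> f =1 g)].

(* The dimension of Q (x)_Z ZM.  The set below is a singleton, since the tensor
   product is unique up to isomorphism and exists as the rational span of [M];
   the default value 0 is never used. *)
Definition rank (q : nat) (M : set 'rV[int]_q) : nat :=
  xget 0%N [set r | exists (T : vectType rat) (t : rat -> 'rV[int]_q -> T),
                      is_rat_tensor (grp M) t /\ \dim {:T} = r].

Definition toQ (q : nat) (x : 'rV[int]_q) : 'rV[rat]_q := map_mx intr x.

Definition scaled (q m : nat) (M : set 'rV[int]_q) : set 'rV[rat]_q :=
  [set m%:R^-1 *: toQ x | x in M].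

Definition Vset (q m : nat) (M : set 'rV[int]_q) : set 'rV[rat]_q :=
  [set a | scaled m M a /\
     [set b - a | b in scaled m M] `&` (@toQ q @` grp M) `<=` @toQ q @` M].

Definition monoid_isomorphic (A B : nmodType) (M : set A) (N : set B) : Prop :=
  exists f : A -> B,
    [/\ set_bij M N f, f 0 = 0
      & forall x y, M x -> M y -> f (x + y) = f x + f y].

(* Main.v *)
Require Import Defs.
From HB Require Import structures.
From mathcomp Require Import all_boot all_order all_algebra.
From mathcomp Require Import all_classical.
From mathcomp Require Import zify ring.

(* Two elements of V_m(M) in the same class modulo ZM differ by elements of M
   in both directions, hence coincide since M is pointed; so
   |V_m(M)| <= |ZM / mZM| = m^rank(M), with equality iff every class modulo mZM
   meets M in a translate a + mM with a in M.  In that case every x in M is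
   uniquely a + m D(x) with a in m V_m(M), and D(x + m y) = D(x) + y; iterating
   D gives the same for m^k.  This is the monoid shadow of flatness of
   Frobenius, and Lech's argument in Kunz's theorem applies: with q = m^k, the
   elements q h_i (h_i the irreducibles of M) are Lech independent,
   independence survives lowering the multiplicities one at a time, and it
   forces sums of the h_i with multiplicities below q to be pairwise distinct.
   As k is arbitrary, M is free on its irreducibles. *)

Import Order.TTheory GRing.Theory Num.Theory.
Local Open Scope classical_set_scope.
Local Open Scope ring_scope.

(** * Lech independence and unique factorization *)

(** Freeness of [S] on the family [h], stated internally; [monoid_isomorphic_orthant] identifies it
    with an isomorphism onto an orthant. *)
Definition monoid_basis {A : nmodType} (S : set A) {t : nat} (h : 'I_t -> A) : Prop :=
  [/\ forall i, S (h i),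
      forall x, S x -> exists c : 'I_t -> nat, x = \sum_i h i *+ c i
    & forall c e : 'I_t -> nat,
        \sum_i h i *+ c i = \sum_i h i *+ e i -> c =1 e].

Section Submonoid.
Context {A : nmodType} {S : set A}.
Hypothesis SM : submonoid S.

Lemma submonoid_sum (I : Type) (r : seq I) (P : pred I) (F : I -> A) :
  (forall i, P i -> S (F i)) -> S (\sum_(i <- r | P i) F i).
Proof. by move=> SF; apply: big_ind => //; [apply: SM.1 | apply: SM.2]. Qed.

Lemma submonoidMn x n : S x -> S (x *+ n).
Proof.
move=> Sx; elim: n => [|n IHn]; first by rewrite mulr0n; apply: SM.1.
by rewrite mulrS; apply: SM.2.
Qed.

End Submonoid.

Section UniqueFactorization.
Context {A : zmodType} {S : set A}.
Hypothesis SM : submonoid S.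
Hypothesis S_pointed : forall x, S x -> S (- x) -> x = 0.

Definition irreducible (x : A) : Prop :=
  [/\ S x, x <> 0 & forall y z, S y -> S z -> x = y + z -> y = 0 \/ z = 0].

Context {t : nat} {h : 'I_t -> A}.
Hypothesis h_inj : injective h.
Hypothesis h_irr : forall i, irreducible (h i).

Let hS i : S (h i). Proof. by case: (h_irr i). Qed.
Let hMS i n : S (h i *+ n). Proof. by apply: submonoidMn. Qed.

(* Lech independence of the monomials [h i *+ c i], read in the monoid [S]. *)
Definition lech_independent (c : 'I_t -> nat) : Prop :=
  forall i j a b, i != j -> S a -> S b -> a + h i *+ c i = b + h j *+ c j ->
  exists l, S (a - h l *+ c l).

(** Adding the missing [c i0 - e] copies of [h i0] to a relation for the lowered multiplicities
    gives one for [c]. If [h i0] stands on the left, the copies go to [b] and [Lc] concludes at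
    once; if it stands on the right, they spoil [a] and [Lc] is used twice. *)
Lemma lech_independent_lower c i0 e : lech_independent c -> (e <= c i0)%N ->
  lech_independent (fun i => if i == i0 then e else c i).
Proof.
move=> Lc le_e; set c' := (X in lech_independent X) => i j a b neq_ij Sa Sb.
have weaken l : S (a - h l *+ c l) -> exists l, S (a - h l *+ c' l).
  move=> Sl; exists l; rewrite /c'; case: eqP => [eq_l|//].
  move: Sl; rewrite eq_l -(subnK le_e) mulrnDr => Sl.
  have -> : a - h i0 *+ e = (a - (h i0 *+ (c i0 - e) + h i0 *+ e)) + h i0 *+ (c i0 - e).
    by rewrite opprD addrAC addrA addrK.
  by apply: SM.2.
rewrite {1 2}/c'; case: (eqVneq i i0) => [Ei|ni].
  have -> : j == i0 = false by rewrite -Ei eq_sym; apply/negbTE.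
  move=> E; have [] := @Lc i0 j a (b + h i0 *+ (c i0 - e)) => //.
  - by rewrite -Ei.
  - by apply: SM.2.
  - by rewrite -{1}(subnK le_e) mulrnDr addrCA -Ei E addrCA addrA (addrC b).
case: (eqVneq j i0) => [Ej|nj]; last first.
  by move=> E; have [] := @Lc i j a b.
move=> E; have [] := @Lc i i0 (a + h i0 *+ (c i0 - e)) b => //.
- by apply: SM.2.
- by rewrite -{2}(subnK le_e) mulrnDr addrAC E -Ej -addrA (addrC (h j *+ e)).
move=> l Sl; case: (eqVneq l i0) => [El|nl].
  exists l; rewrite /c' El eqxx; move: Sl.
  by rewrite El -{2}(subnK le_e) mulrnDr opprD addrA addrK.
(* For [l != i0] the membership [Sl] is itself a relation between [h i0] and [h l] whose left
   remainder is the original [a], so [Lc] applies again. *)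
have [] := @Lc i0 l a (a + h i0 *+ (c i0 - e) - h l *+ c l + h i0 *+ e) => //.
- by rewrite eq_sym.
- by apply: SM.2.
- by rewrite addrAC subrK -addrA -mulrnDr subnK.
Qed.

Lemma lech_independent_le {q c} :
  lech_independent (fun=> q) -> (forall i, c i <= q)%N -> lech_independent c.
Proof.
move=> Lq le_cq.
suff L (s : seq 'I_t) : lech_independent (fun i => if i \in s then c i else q).
  have <- // : (fun i => if i \in enum 'I_t then c i else q) = c.
  by apply/funext => i; rewrite mem_enum.
elim: s => [//|i0 s IHs].
have -> : (fun i => if i \in i0 :: s then c i else q) =
    fun i => if i == i0 then c i0 else if i \in s then c i else q.
  by apply/funext => i; rewrite inE; case: eqP => // ->.
by apply: lech_independent_lower => //; case: ifP.
Qed.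

(** Induction on the total multiplicity: if [h j] divided the sum, splitting off all copies of some
    [h i] that occurs would give a Lech relation, and its conclusion is the same divisibility for a
    smaller sum. The empty sum is excluded by pointedness. *)
Lemma not_dvd_monomial q c j : lech_independent (fun=> q) ->
  (forall i, c i < q)%N -> c j = 0%N -> ~ S (\sum_i h i *+ c i - h j).
Proof.
move=> Lq; move: {2}(\sum_i c i).+1%N (ltnSn (\sum_i c i)%N) => n; elim: n c j => // n IHn c j.
rewrite ltnS => le_cn lt_cq cj0 Sj.
have Sdrop x l k : (0 < k)%N -> S (x - h l *+ k) -> S (x - h l).
  case: k => // k _ Sx; have -> : x - h l = x - h l *+ k.+1 + h l *+ k.
    by rewrite mulrSr opprD addrA addrAC subrK.
  exact: SM.2.
have [c0|] := boolP [forall i, c i == 0%N].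
  have [_ nz _] := h_irr j; apply: nz; apply: S_pointed => //.
  move: Sj; rewrite big1 ?add0r// => i _.
  by rewrite (eqP (forallP c0 i)) mulr0n.
rewrite negb_forall => /existsP[i]; rewrite -lt0n => ci0.
have neq_ij : i != j by apply/eqP => E; rewrite E cj0 in ci0.
pose c1 l := if l == i then 0%N else c l.
have sum1 : \sum_l h l *+ c l = \sum_l h l *+ c1 l + h i *+ c i.
  rewrite (bigD1 i)//= [X in _ = X + _](bigD1 i)//= {1}/c1 eqxx mulr0n add0r addrC.
  by congr (_ + _); apply: eq_bigr => l /negbTE ni; rewrite /c1 ni.
have lt_c1 : (\sum_l c1 l < n)%N.
  apply: leq_trans le_cn; rewrite (bigD1 i)//= [X in (_ < X)%N](bigD1 i)//=.
  rewrite {1}/c1 eqxx add0n (_ : (\sum_(i0 < t | _) c1 i0 = \sum_(i0 < t | i0 != i) c i0)%N).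
    by rewrite -addn1 addnC leq_add2r.
  by apply: eq_bigr => l /negbTE ni; rewrite /c1 ni.
have c1q l : (c1 l < q)%N.
  by rewrite /c1; case: eqP => // _; apply: leq_trans (lt_cq i).
(* Since [c j = 0], [k j] is 1, matching the single [h j] removed. The other multiplicities exceed
   [c] by one, so that cancelling [h l] from the remaining sum leaves exactly one copy to subtract;
   [c l < q] keeps them at most [q]. *)
pose k l := if l == i then c i else (c l).+1.
have Lk : lech_independent k.
  by apply: (lech_independent_le Lq) => l; rewrite /k; case: eqP => // _; apply: ltnW.
have [||l] := Lk i j (\sum_l h l *+ c1 l) _ neq_ij _ Sj.
- by apply: submonoid_sum.
- by rewrite /k eqxx eq_sym (negbTE neq_ij) cj0 mulr1n subrK sum1.
rewrite /k; case: eqP => [-> /(Sdrop _ _ _ ci0)|/eqP nli].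
  by apply: IHn => //; rewrite /c1 eqxx.
pose c2 l' := if l' == l then 0%N else c1 l'.
have -> : \sum_l h l *+ c1 l - h l *+ (c l).+1 = \sum_l h l *+ c2 l - h l.
  rewrite (bigD1 l)//= [X in _ = X - _](bigD1 l)//= {1}/c1 {1}/c2 eqxx (negbTE nli) mulr0n add0r.
  rewrite mulrSr opprD addrA (addrAC (h l *+ c l)) subrr add0r.
  by congr (_ - _); apply: eq_bigr => l' /negbTE ni; rewrite /c2 ni.
apply: IHn; rewrite ?/c2 ?eqxx//.
  apply: leq_ltn_trans lt_c1; apply: leq_sum => l' _.
  by case: eqP.
by move=> l'; case: eqP => // _; apply: leq_trans (lt_cq i).
Qed.

(** If [c j < e j], cancelling [c j] copies of [h j] leaves a sum without [h j] that [h j] still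
    divides, against [not_dvd_monomial]. *)
Lemma lech_unique_factorization q c e : lech_independent (fun=> q) ->
  (forall i, c i < q)%N -> (forall i, e i < q)%N ->
  \sum_i h i *+ c i = \sum_i h i *+ e i -> c =1 e.
Proof.
move=> Lq; suff le_ec : forall c e, (forall i, c i < q)%N ->
    \sum_i h i *+ c i = \sum_i h i *+ e i -> forall j, (e j <= c j)%N.
  by move=> cq eq E j; apply/eqP; rewrite eqn_leq (le_ec _ _ cq E) (le_ec _ _ eq (esym E)).
move=> {}c {}e cq E j; rewrite leqNgt; apply/negP => lt_ce.
pose c' l := if l == j then 0%N else c l.
apply: (@not_dvd_monomial q c' j) => //.
- by move=> i; rewrite /c'; case: eqP => // _; apply: leq_trans (cq i).
- by rewrite /c' eqxx.
have -> : \sum_i h i *+ c' i = \sum_i h i *+ c i - h j *+ c j.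
  rewrite (bigD1 j)//= [X in _ = X - _](bigD1 j)//= {1}/c' eqxx mulr0n add0r addrAC subrr add0r.
  by apply: eq_bigr => l /negbTE nl; rewrite /c' nl.
rewrite E (bigD1 j)//= (addrAC (h j *+ e j)) -mulrnBr ?(ltnW lt_ce)//.
case: (e j - c j)%N (subn_gt0 (c j) (e j)) => [|d]; first by rewrite lt_ce.
move=> _; rewrite mulrS [X in S X]addrC -(addrA (h j)) addKr.
by apply: SM.2 => //; apply: submonoid_sum.
Qed.

End UniqueFactorization.

(** * Floor maps and freeness on the irreducibles *)

Section Floor.
Context {A : zmodType} {S : set A}.
Hypothesis SM : submonoid S.

(* [D x] is the largest [y] in [S] such that [m y] divides [x]. *)
Definition floor_map (m : nat) (D : A -> A) : Prop :=
  [/\ forall x, S x -> S (D x),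
      forall x, S x -> S (x - D x *+ m)
    & forall x y, S x -> S y -> D (x + y *+ m) = D x + y].

(** Provides arbitrarily large multiplicities: the remainders of the successive steps, scaled by
    powers of [m], telescope. *)
Lemma floor_map_iter {m D} k :
  floor_map m D -> floor_map (m ^ k) (iter k D).
Proof.
move=> [D1 D2 D3]; elim: k => [|k [I1 I2 I3]]; split => //= x.
- by rewrite expn0 mulr1n subrr => _; apply: SM.1.
- by move=> Sx; apply/D1/I1.
- move=> Sx; have := SM.2 _ _ (I2 x Sx) (submonoidMn SM _ (m ^ k)%N (D2 _ (I1 x Sx))).
  by rewrite mulrnBl -mulrnA -expnS addrA subrK.
- move=> y Sx Sy; rewrite expnS mulrnA I3//; last exact: submonoidMn.
  by rewrite D3//; apply: I1.
Qed.

(** Applying [D] to a relation gives [D a + h i = D b + h j]. If [D a] were 0, irreducibility of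
    [h i] would force [h i = h j]. So some [h l] divides [D a], and then [m] copies of it divide
    [a]. *)
Lemma floor_map_lech {m D t} {h : 'I_t -> A} : injective h ->
  (forall i, irreducible (S := S) (h i)) ->
  (forall x, S x -> exists c : 'I_t -> nat, x = \sum_i h i *+ c i) ->
  floor_map m D -> lech_independent (S := S) (h := h) (fun=> m).
Proof.
move=> h_inj h_irr h_gen [D1 D2 D3] i j a b neq_ij Sa Sb /(congr1 D).
have [[Si nzi irri] [Sj nzj _]] := (h_irr i, h_irr j).
rewrite !D3// => E.
have hMS l n : S (h l *+ n) by case: (h_irr l) => Sl _ _; apply: submonoidMn.
have [c Dc] := h_gen _ (D1 _ Sa).
have [c0|] := boolP [forall l, c l == 0%N].
  have [|Db0|//] := irri (D b) (h j) (D1 _ Sb) Sj.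
    rewrite -E Dc big1 ?add0r// => l _.
    by rewrite (eqP (forallP c0 l)) mulr0n.
  case/eqP: neq_ij; apply: h_inj; move: E; rewrite Db0 add0r => <-.
  rewrite Dc big1 ?add0r// => l _.
  by rewrite (eqP (forallP c0 l)) mulr0n.
rewrite negb_forall => /existsP[l]; rewrite -lt0n => cl0; exists l.
have -> : a - h l *+ m = (a - D a *+ m) + (D a - h l) *+ m.
  by rewrite mulrnBl addrA subrK.
apply: SM.2; first exact: D2.
apply: submonoidMn => //; rewrite Dc (bigD1 l)//= -(prednK cl0) mulrS.
rewrite [X in S X]addrC -(addrA (h l)) addKr; apply: SM.2 => //.
exact: submonoid_sum.
Qed.

(** Irreducibles belong to every generating list, so there are finitely many; the additive weight
    [w], zero only at 0, makes splitting into irreducibles terminate. *)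
Lemma irreducible_generators {w : A -> nat} {s : seq A} :
  (forall x, S x -> w x = 0%N -> x = 0) ->
  (forall x y, S x -> S y -> w (x + y) = (w x + w y)%N) ->
  S = smallest (@submonoid _) [set` s] ->
  exists t (h : 'I_t -> A), [/\ injective h, forall i, irreducible (S := S) (h i)
    & forall x, S x -> exists c : 'I_t -> nat, x = \sum_i h i *+ c i].
Proof.
move=> w0 wD Ss; pose H := undup [seq x <- s | `[< irreducible (S := S) x >]].
have irr_in_s x : irreducible (S := S) x -> x \in s.
  have : (smallest (@submonoid _) [set` s]) x -> irreducible (S := S) x -> x \in s.
    (* This property defines a submonoid containing [s]: an irreducible sum of two elements of [S]
       has a zero summand and equals the other one. *)
    move=> sx; suff [] : S x /\ (irreducible (S := S) x -> x \in s) by [].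
    move: x sx; apply: smallest_sub; last first.
      by move=> x xs; split=> // ; rewrite Ss; apply: sub_gen_smallest.
    split; first by split; [exact: SM.1 | case].
    move=> x y [Sx xs] [Sy ys]; split; first exact: SM.2.
    move=> Ixy; have [_ _ /(_ x y Sx Sy erefl)[x0|y0]] := Ixy.
      by move: Ixy ys; rewrite x0 add0r => Iy; apply.
    by move: Ixy xs; rewrite y0 addr0 => Ix; apply.
  by rewrite -Ss => sx Ix; case: (Ix) => /sx + _ _; apply.
have memH x : (x \in H) <-> irreducible (S := S) x.
  rewrite mem_undup mem_filter; split=> [/andP[/asboolP]//|Ix].
  by rewrite irr_in_s// andbT; apply/asboolP.
exists (size H), (fun i => H`_i); split.
- move=> i j /eqP; rewrite nth_uniq ?undup_uniq// => /eqP; exact: val_inj.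
- by move=> i; apply/memH; apply: mem_nth.
move=> x; move: {2}(w x).+1 (ltnSn (w x)) => n; elim: n x => // n IH x.
rewrite ltnS => le_w Sx.
have [->|/eqP nzx] := eqVneq x 0.
  by exists (fun=> 0%N); rewrite big1.
have [Ix|nIx] := pselect (irreducible (S := S) x).
  have xH : (index x H < size H)%N by rewrite index_mem; apply/memH.
  exists (fun i => (i == Ordinal xH) : nat).
  rewrite (bigD1 (Ordinal xH))//= eqxx mulr1n nth_index; last exact/memH.
  by rewrite big1 ?addr0// => i /negbTE ->.
have [y [z [Sy Sz xE ny nz]]] : exists y z, [/\ S y, S z, x = y + z, y <> 0 & z <> 0].
  apply: contrapT => H0; apply: nIx; split=> // y z Sy Sz xE.
  have [->|/eqP ny] := eqVneq y 0; first by left.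
  have [->|/eqP nz] := eqVneq z 0; first by right.
  by case: H0; exists y, z.
have wy : (0 < w y)%N by rewrite lt0n; apply/eqP => /(w0 _ Sy).
have wz : (0 < w z)%N by rewrite lt0n; apply/eqP => /(w0 _ Sz).
have wx : w x = (w y + w z)%N by rewrite xE wD.
have [c yE] : exists c : 'I_(size H) -> nat, y = \sum_(i < size H) H`_i *+ c i.
  by apply: IH => //; lia.
have [e zE] : exists c : 'I_(size H) -> nat, z = \sum_(i < size H) H`_i *+ c i.
  by apply: IH => //; lia.
rewrite xE yE zE; exists (fun i : 'I_(size H) => c i + e i)%N.
by rewrite -big_split; apply: eq_bigr => i _; rewrite mulrnDr.
Qed.

Lemma floor_map_basis {m D} {w : A -> nat} {s : seq A} :
  (forall x, S x -> w x = 0%N -> x = 0) ->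
  (forall x y, S x -> S y -> w (x + y) = (w x + w y)%N) ->
  S = smallest (@submonoid _) [set` s] ->
  (1 < m)%N -> floor_map m D -> exists t (h : 'I_t -> A), monoid_basis S h.
Proof.
move=> w0 wD Ss m1 Dm.
have [t [h [h_inj h_irr h_gen]]] := irreducible_generators w0 wD Ss.
exists t, h; split=> [i|//|c e E]; first by case: (h_irr i).
have S_pointed x : S x -> S (- x) -> x = 0.
  move=> Sx Snx; apply: w0 => //; move: (wD x (- x) Sx Snx) (wD 0 0 SM.1 SM.1).
  by rewrite addrN addr0; lia.
(* As [k < m ^ k], the iterated floor map for [m ^ k] bounds all multiplicities in the given
   equation. *)
pose k := \max_i maxn (c i) (e i).
have lt_k i : (maxn (c i) (e i) < m ^ k)%N.
  apply: leq_ltn_trans (ltn_expl k m1).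
  exact: (@leq_bigmax _ (fun i => maxn (c i) (e i))).
apply: (lech_unique_factorization SM S_pointed h_irr (m ^ k)%N) => //.
- exact: floor_map_lech h_inj h_irr h_gen (floor_map_iter k Dm).
- by move=> i; apply: leq_ltn_trans (lt_k i); apply: leq_maxl.
- by move=> i; apply: leq_ltn_trans (lt_k i); apply: leq_maxr.
Qed.

End Floor.

(** * Lattice bases and rank *)

Definition lattice_basis {q r : nat} (G : set 'rV[int]_q) (B : 'M[int]_(r, q)) : Prop :=
  (forall x, G x <-> exists u : 'rV_r, x = u *m B) /\
  (forall u : 'rV_r, u *m B = 0 -> u = 0).

Lemma grpP {q} {M : set 'rV[int]_q} : submonoid M ->
  forall g, grp M g <-> exists x y, [/\ M x, M y & g = x - y].
Proof.
move=> SM g; split.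
  apply: (@smallest_sub _ _ _ [set g | exists x y, [/\ M x, M y & g = x - y]]).
    split; first by exists 0, 0; rewrite subrr; split => //; apply: SM.1.
    move=> _ _ [x [y [Mx My ->]]] [z [w [Mz Mw ->]]].
    exists (x + w), (y + z); split; [exact: SM.2 | exact: SM.2 |].
    by rewrite opprB opprD addrACA.
  by move=> x Mx; exists x, 0; rewrite subr0; split => //; apply: SM.1.
move=> [x [y [Mx My ->]]] C [[C0 CB] MC].
by apply: CB; apply: MC.
Qed.

(** By Smith normal form [S = L D R] with [L], [R] invertible, the rows of [S] and of [D R] span the
    same lattice, and the nonzero rows of the diagonal [D] are independent. *)
Lemma lattice_basis_of_rows {q k} (S : 'M[int]_(k, q)) :
  exists r (B : 'M[int]_(r, q)),
    lattice_basis [set x | exists u : 'rV_k, x = u *m S] B.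
Proof.
have [L Lu [R Ru [d _ SE]]] := int_Smith_normal_form S.
set D := (X in L *m X) in SE.
pose nzd := [pred i : 'I_k | row i D != 0].
pose f (i : 'I_#|nzd|) : 'I_k := enum_val i.
have DE (u : 'rV_k) (j : 'I_q) : (u *m D) 0 j = \sum_i u 0 i * (d`_i *+ (i == j :> nat)).
  by rewrite mxE; apply: eq_bigr => i _; rewrite mxE.
(* A combination of the selected rows is one of all rows of [D], with coefficient 0 at unselected
   indices; each inner sum has at most one term. *)
have BE (u : 'rV_#|nzd|) :
    u *m rowsub f D = (\row_i \sum_(l | f l == i) u 0 l) *m D.
  apply/rowP => j; rewrite mxE DE.
  under [RHS]eq_bigr => i _ do rewrite mxE mulr_suml.
  rewrite (exchange_big_dep predT)//=; apply: eq_bigr => l _.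
  by rewrite (big_pred1 (f l)) ?mxE // => i; rewrite /= eq_sym.
exists #|nzd|, (rowsub f D *m R); split.
  move=> x; split=> [[u ->]|[u ->]].
    exists (\row_l (u *m L) 0 (f l)); rewrite SE !mulmxA; congr (_ *m R).
    rewrite BE; apply/rowP => j; rewrite !DE; apply: eq_bigr => i _.
    rewrite [in RHS]mxE; have [ni|] := boolP (i \in nzd).
      rewrite (big_pred1 (enum_rank_in ni i)) => [|l].
        by rewrite mxE /f enum_rankK_in.
      apply/eqP/eqP => [fl|->]; last by rewrite /f enum_rankK_in.
      by apply: enum_val_inj; rewrite enum_rankK_in.
    rewrite inE negbK => /eqP/rowP/(_ j); rewrite !mxE => ->.
    by rewrite !mulr0.
  exists ((\row_i \sum_(l | f l == i) u 0 l) *m invmx L).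
  by rewrite SE !mulmxA mulmxKV// BE.
move=> u /(congr1 (mulmx^~ (invmx R))); rewrite mulmxA mulmxK// mul0mx => u0.
apply/rowP => l; rewrite mxE.
have : f l \in nzd by apply: enum_valP.
rewrite inE => /eqP nz; apply/eqP; apply: contra_notT nz => ul0.
apply/rowP => j; rewrite !mxE; case: eqP => [flj|]; last by rewrite mulr0n.
move/rowP: u0 => /(_ j); rewrite mxE (bigD1 l)//= big1 => [|l' nl].
  by rewrite !mxE flj eqxx addr0 => /eqP; rewrite mulf_eq0 (negbTE ul0) => /eqP.
rewrite !mxE -flj; case: eqP => [/val_inj/enum_val_inj E|]; last by rewrite mulr0n mulr0.
by rewrite E eqxx in nl.
Qed.

Lemma grp_basis {q} {M : set 'rV[int]_q} : affine_monoid M ->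
  exists r (B : 'M[int]_(r, q)), lattice_basis (grp M) B.
Proof.
move=> [SM [s Ms] _].
have [r [B GB]] := lattice_basis_of_rows (\matrix_(i < size s) s`_i).
exists r, B; suff -> : grp M =
  [set x | exists u : 'rV_(size s), x = u *m \matrix_(i < size s) s`_i] by [].
have C : subgroup [set x : 'rV[int]_q | exists u : 'rV_(size s), x = u *m \matrix_(i < size s) s`_i].
  split; first by exists 0; rewrite mul0mx.
  by move=> _ _ [u ->] [v ->]; exists (u - v); rewrite mulmxBl.
apply/seteqP; split.
  apply: smallest_sub => //; rewrite Ms; apply: smallest_sub.
    split; first exact: C.1.
    move=> x y Cx Cy; rewrite -(opprK y); apply: C.2 => //.
    by rewrite -sub0r; apply: C.2 => //; apply: C.1.
  move=> x /= xs; have ix : (index x s < size s)%N by rewrite index_mem.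
  exists (delta_mx 0 (Ordinal ix)); rewrite -rowE.
  by apply/rowP => j; rewrite !mxE /= nth_index.
move=> _ [u ->] G [SG MG]; rewrite mulmx_sum_row.
have SD x y : G x -> G y -> G (x + y).
  move=> Gx Gy; rewrite -(opprK y); apply: SG.2 => //.
  by rewrite -sub0r; apply: SG.2 => //; apply: SG.1.
have Gn x n : G x -> G (x *+ n).
  by move=> Gx; elim: n => [|n IH]; [rewrite mulr0n; apply: SG.1 | rewrite mulrS; apply: SD].
apply: big_ind => [||i _]; [exact: SG.1 | exact: SD |].
have Gi : G (row i (\matrix_(i < size s) s`_i)).
  have -> : row i (\matrix_(i < size s) s`_i) = s`_i by apply/rowP => j; rewrite !mxE.
  by apply: MG; rewrite Ms; apply: sub_gen_smallest; apply: mem_nth.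
rewrite -(intz (u 0 i)) scaler_int; case: (u 0 i) => n; first exact: Gn.
by rewrite NegzE mulrNz -sub0r; apply: SG.2; [exact: SG.1 | apply: Gn].
Qed.

(** * The rank as the size of a lattice basis *)

Section Rank.
Context {q r : nat} {M : set 'rV[int]_q} {B : 'M[int]_(r, q)}.
Hypothesis GB : lattice_basis (grp M) B.

(** Unique on the group by [basis_inj]; off the group it takes the default [0]. *)
Definition coords (x : 'rV[int]_q) : 'rV[int]_r :=
  xget 0 [set u : 'rV_r | x = u *m B].

Lemma basis_inj (u v : 'rV_r) : u *m B = v *m B -> u = v.
Proof.
move=> E; apply/eqP; rewrite -subr_eq0; apply/eqP/GB.2.
by rewrite mulmxBl E subrr.
Qed.

Lemma coordsK (u : 'rV_r) : coords (u *m B) = u.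
Proof. by rewrite /coords; case: xgetP => [v _ /basis_inj -> //|/(_ u)[]]. Qed.

(** A lattice basis identifies the tensor product with row vectors over the rationals. Uniqueness
    holds because every vector is a sum of pure tensors on basis elements. *)
Lemma rat_tensor_coords :
  is_rat_tensor (grp M) (fun c x => c *: map_mx intr (coords x) : 'rV[rat]_r).
Proof.
have G_of x : grp M x -> exists u : 'rV_r, x = u *m B by move/GB.1.
split.
- split; first by move=> c e x _; rewrite scalerDl.
  move=> c _ _ /G_of[u ->] /G_of[v ->].
  by rewrite -mulmxDl !coordsK map_mxD scalerDr.
- by move=> c e x _; rewrite scalerA.
move=> W b [bD1 bD2]; split; last first.
  move=> f g fE gE v; rewrite (matrix_sum_delta v) big_ord1 !raddf_sum.
  apply: eq_bigr => i _.
  have E : v 0 i *: delta_mx 0 i =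
      v 0 i *: map_mx intr (coords (delta_mx 0 i *m B)) :> 'rV[rat]_r.
    by rewrite coordsK map_delta_mx.
  have Gi : grp M (delta_mx 0 i *m B) by apply/GB.1; exists (delta_mx 0 i).
  by rewrite E fE // gE.
have row_in i : grp M (row i B) by apply/GB.1; exists (delta_mx 0 i); rewrite -rowE.
(* The formula is forced by the values on the basis rows. *)
pose f (v : 'rV[rat]_r) : W := \sum_i b (v 0 i) (row i B).
have f_add : zmod_morphism f.
  have bB c e i : b (c - e) (row i B) = b c (row i B) - b e (row i B).
    by apply/eqP; rewrite eq_sym subr_eq -bD1 ?subrK.
  move=> u v; rewrite /f -sumrB; apply: eq_bigr => i _.
  by rewrite !mxE bB.
pose F : {additive 'rV[rat]_r -> W} := HB.pack f (GRing.isZmodMorphism.Build _ _ f f_add).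
exists F => c x Gx; have [u xE] := G_of _ Gx; rewrite xE coordsK /= /f.
have GD y z : grp M y -> grp M z -> grp M (y - z).
  by move=> /G_of[v ->] /G_of[w ->]; rewrite -mulmxBl; apply/GB.1; exists (v - w).
have GDa y z : grp M y -> grp M z -> grp M (y + z).
  by move=> /G_of[v ->] /G_of[w ->]; rewrite -mulmxDl; apply/GB.1; exists (v + w).
have G0 : grp M 0 by apply/GB.1; exists 0; rewrite mul0mx.
have b0r e : b e 0 = 0 by apply: (addIr (b e 0)); rewrite -bD2// addr0 add0r.
have b0l y : grp M y -> b 0 y = 0.
  by move=> Gy; apply: (addIr (b 0 y)); rewrite -bD1// addr0 add0r.
have bsum (I : Type) (l : seq I) (g : I -> 'rV_q) : (forall i, grp M (g i)) ->
    b c (\sum_(i <- l) g i) = \sum_(i <- l) b c (g i).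
  move=> Gg; elim: l => [|i l IH]; first by rewrite !big_nil b0r.
  by rewrite !big_cons bD2 ?IH//; apply: big_ind.
have bn e y n : grp M y -> b (e *+ n) y = b e (y *+ n) /\ grp M (y *+ n).
  move=> Gy; elim: n => [|n [IH Gn]]; first by rewrite !mulr0n b0r b0l.
  by rewrite !mulrS bD1// bD2// IH; split=> //; apply: GDa.
(* Biadditivity alone moves integers from one factor to the other, which makes [f] agree with [b] on
   all pure tensors. *)
have bz e y (z : int) : grp M y -> b (e * z%:~R) y = b e (z *: y).
  move=> Gy; rewrite mulrzr -[in RHS](intz z) scaler_int.
  case: z => n; first by case: (bn e y n Gy).
  have [En Gn] := bn e y n.+1 Gy; rewrite NegzE !mulrNz.
  apply: (addIr (b e (y *+ n.+1))); rewrite -[in RHS]bD2 ?addNr ?b0r//.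
    by rewrite -En -bD1// addNr b0l.
  by rewrite -sub0r; apply: GD.
rewrite mulmx_sum_row bsum => [|i]; last first.
  by apply/GB.1; exists (u 0 i *: delta_mx 0 i); rewrite -scalemxAl -rowE.
by apply: eq_bigr => i _; rewrite !mxE bz.
Qed.

End Rank.

(** Additive maps between rational vector spaces are automatically linear. *)
Lemma additive_bij_dim (T U : vectType rat) (f : {additive T -> U})
  (g : {additive U -> T}) : cancel f g -> cancel g f -> \dim {:T} = \dim {:U}.
Proof.
suff le (V W : vectType rat) (f0 : {additive V -> W}) (g0 : {additive W -> V}) :
    cancel f0 g0 -> (\dim {:V} <= \dim {:W})%N.
  by move=> fK gK; apply/eqP; rewrite eqn_leq !(le _ _ _ _ fK, le _ _ _ _ gK).
move=> fK.
have f_lin : scalable f0 by apply: rat_linear; apply: raddfB.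
pose F : {linear V -> W} := HB.pack (f0 : V -> W) f0 (GRing.isScalable.Build _ _ _ _ f0 f_lin).
have kF : lker (linfun F) == 0%VS.
  by apply/lker0P => x y; rewrite !lfunE => /(can_inj fK).
by rewrite -(limg_dim_eq (f := linfun F)) ?(eqP kF) ?capv0// dimvS// subvf.
Qed.

(** Two universal objects are isomorphic by mutually inverse additive maps. *)
Lemma rat_tensor_dim {A : zmodType} {G : set A} {T U : vectType rat} {t u} :
  is_rat_tensor G (T := T) t -> is_rat_tensor G (T := U) u -> \dim {:T} = \dim {:U}.
Proof.
move=> [tb _ tU] [ub _ uU].
have [[f fE] _] := tU U u ub; have [[g gE] _] := uU T t tb.
apply: (additive_bij_dim _ _ f g) => x.
  have [_ uniq] := tU T t tb.
  apply: (uniq (g \o f) idfun) => // r y Gy.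
  by rewrite /= fE// gE.
have [_ uniq] := uU U u ub.
apply: (uniq (f \o g) idfun) => // r y Gy.
by rewrite /= gE// fE.
Qed.

Lemma rankE {q r} {M : set 'rV[int]_q} {B : 'M[int]_(r, q)} :
  lattice_basis (grp M) B -> rank M = r.
Proof.
move=> GB; rewrite /rank; case: xgetP => [n _ [T [t [Tt <-]]]|].
  by rewrite (rat_tensor_dim Tt (rat_tensor_coords GB)) dimvf /dim /= mul1n.
move=> /(_ r); case; exists 'rV[rat]_r, (fun c x => c *: map_mx intr (coords (B := B) x)).
by split; [exact: rat_tensor_coords | rewrite dimvf /dim /= mul1n].
Qed.

(** * Monoid bases and isomorphisms with an orthant *)

Definition rV_of {t} (c : 'I_t -> nat) : 'rV[int]_t := \row_i (c i)%:Z.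

Lemma rV_of_orthant t (u : 'rV[int]_t) :
  @orthant t u -> rV_of (fun i => `|u 0%R i|%N) = u.
Proof. by move=> u0; apply/rowP => i; rewrite mxE gez0_abs. Qed.

(** Preimages of the unit vectors form a basis; conversely, multiplicities with respect to a basis
    give the isomorphism. *)
Lemma monoid_isomorphic_orthant {A : nmodType} {M : set A} {t} : submonoid M ->
  monoid_isomorphic M (@orthant t) <-> exists h : 'I_t -> A, monoid_basis M h.
Proof.
move=> SM; split=> [[f [fbij f0 fD]]|[h [hS h_gen h_inj]]].
  have [fM finj fsurj] := fbij.
  have Hi i : exists2 x, M x & f x = delta_mx 0 i.
    by apply: fsurj => j /=; rewrite mxE; case: (_ && _).
  pose h i : A := s2val (cid2 (Hi i)).
  have hM i : M (h i) by rewrite /h; case: cid2.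
  have hE i : f (h i) = delta_mx 0 i by rewrite /h; case: cid2.
  have fMn x n : M x -> f (x *+ n) = f x *+ n.
    move=> Mx; elim: n => [|n IH]; first by rewrite !mulr0n.
    by rewrite !mulrS fD ?IH//; apply: submonoidMn.
  have fsum c : f (\sum_i h i *+ c i) = rV_of c.
    have [_ ->] : M (\sum_i h i *+ c i) /\ f (\sum_i h i *+ c i) = \sum_i f (h i *+ c i).
      apply: (big_ind2 (fun x y => M x /\ f x = y)) => [|x y z w [Mx <-] [Mz <-]|i _].
      - by split=> //; exact: SM.1.
      - by split; [exact: SM.2 | exact: fD].
      - by split=> //; apply: submonoidMn.
    apply/rowP => j; rewrite summxE mxE (bigD1 j)//= fMn// hE big1 => [|i ij].
      by rewrite mulmxnE mxE !eqxx addr0 -mulrnA mul1n natz.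
    by rewrite fMn// hE mulmxnE mxE eqxx eq_sym (negbTE ij) mul0rn.
  exists h; split=> //.
  - move=> x Mx; exists (fun i => `|f x 0%R i|%N).
    apply: finj; [by rewrite inE | | by rewrite fsum rV_of_orthant//; apply: fM].
    by rewrite inE; apply: (submonoid_sum SM) => i _; apply: (submonoidMn SM).
  - move=> c e /(congr1 f); rewrite !fsum => /rowP E i.
    by have := E i; rewrite !mxE => -[].
have [c cE] : {c : A -> 'I_t -> nat & forall x, M x -> x = \sum_i h i *+ c x i}.
  apply: (@choice _ _ (fun x c => M x -> x = \sum_i h i *+ c i)) => x.
  by have [/h_gen[c ->]|nMx] := pselect (M x); [exists c | exists (fun=> 0%N)].
have hM e : M (\sum_i h i *+ e i) by apply: (submonoid_sum SM) => i _; apply: (submonoidMn SM).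
have cK e : c (\sum_i h i *+ e i) = e.
  by apply/funext/h_inj; rewrite -cE.
exists (fun x => rV_of (c x)); split.
- split=> [x Mx i|x y|u u0].
  + by rewrite mxE.
  + rewrite !inE => Mx My /rowP E; rewrite (cE x)// (cE y)//.
    by apply: eq_bigr => i _; have := E i; rewrite !mxE => -[->].
  + exists (\sum_i h i *+ `|u 0%R i|%N); first exact: hM.
    by rewrite cK rV_of_orthant.
- have -> : (0 : A) = \sum_i h i *+ 0 by rewrite big1.
  by rewrite cK; apply/rowP => i; rewrite !mxE.
- move=> x y Mx My; have -> : c (x + y) = fun i => (c x i + c y i)%N.
    rewrite -[RHS]cK; congr c; rewrite {1}(cE x)// {1}(cE y)// -big_split.
    by apply: eq_bigr => i _; rewrite mulrnDr.
  by apply/rowP => i; rewrite !mxE PoszD.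
Qed.

(** * Classes modulo mZM *)

(** An injection between finite sets of equal size is onto; this turns the cardinality condition
    into surjectivity of the residue map. *)
Lemma card_eq_injP {T : Type} {K : finType} {V : set T} {f : T -> K} : set_inj V f ->
  (V #= `I_#|K|)%card <-> forall k, exists2 a, V a & f a = k.
Proof.
move=> f_inj; split=> [/card_set_bijP[g [gV g_inj g_surj]] k|f_surj].
  have gsurj (i : 'I_#|K|) : exists2 a, V a & g a = i.
    by have [|a] := g_surj i; [exact: ltn_ord | exists a].
  pose b i := s2val (cid2 (gsurj i)).
  have bV i : V (b i) by rewrite /b; case: cid2.
  have bK i : g (b i) = i by rewrite /b; case: cid2.
  have fb_inj : injective (f \o b).
    move=> i j /= E; apply: val_inj; rewrite /= -!bK; congr g.
    by apply: f_inj => //; apply: mem_set.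
  have /codomP[i ->] : k \in codom (f \o b) by apply: inj_card_onto; rewrite ?card_ord.
  by exists (b i).
apply/card_set_bijP; exists (fun a => enum_rank (f a) : nat); split.
- by move=> a _ /=.
- by move=> x y xV yV /val_inj/enum_rank_inj; apply: f_inj.
- move=> k /= kK; have [a Va E] := f_surj (enum_val (Ordinal kK)).
  by exists a => //; rewrite E enum_valK.
Qed.

(* [m V_m(M)], a subset of [M]. *)
Definition Vnumerators {q : nat} (m : nat) (M : set 'rV[int]_q) : set 'rV[int]_q :=
  [set a | M a /\ forall b g, M b -> grp M g -> b - a = g *+ m ->
    exists2 c, M c & b = a + c *+ m].

Lemma toQ_inj q : injective (@toQ q).
Proof.
by move=> x y /matrixP E; apply/matrixP => i j; have := E i j; rewrite !mxE => /intr_inj.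
Qed.

Lemma toQB q (x y : 'rV[int]_q) : toQ (x - y) = toQ x - toQ y.
Proof. by rewrite /toQ map_mxB. Qed.

Lemma toQMn q (x : 'rV[int]_q) n : toQ (x *+ n) = n%:R *: toQ x.
Proof. by rewrite scaler_nat /toQ raddfMn. Qed.

Lemma scaled_inj q m : (0 < m)%N ->
  injective (fun x : 'rV[int]_q => m%:R^-1 *: toQ x).
Proof.
move=> m0 x y /= E; apply/toQ_inj/(scalerI _ E).
by rewrite invr_neq0// pnatr_eq0 -lt0n.
Qed.

Lemma VsetE q m (M : set 'rV[int]_q) : (0 < m)%N ->
  Vset m M = (fun x => m%:R^-1 *: toQ x) @` Vnumerators m M.
Proof.
move=> m0; have mu : m%:R != 0 :> rat by rewrite pnatr_eq0 -lt0n.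
have subE (a b g : 'rV[int]_q) :
    m%:R^-1 *: toQ b - m%:R^-1 *: toQ a = toQ g <-> b - a = g *+ m.
  rewrite -scalerBr -toQB; split=> [E|->].
    by apply: toQ_inj; rewrite toQMn -E scalerA mulfV// scale1r.
  by rewrite toQMn scalerA mulVf// scale1r.
apply/seteqP; split=> [x [[a Ma <-] aV]|x [a [Ma aV] <-]].
  exists a => //; split=> // b g Mb Gg /subE E.
  have [c Mc cE] : (@toQ q @` M) (toQ g).
    by apply: aV; split; [exists (m%:R^-1 *: toQ b) => //; exists b | exists g].
  exists c => //; move: E; rewrite -cE => /subE <-.
  by rewrite addrC subrK.
split; first by exists a.
move=> _ [[_ [b Mb <-] <-]] [g Gg /esym E].
have [c Mc cE] := aV b g Mb Gg ((subE a b g).1 E).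
by exists c => //; apply/esym/subE; rewrite cE addrC addKr.
Qed.

Section Classes.
Context {q r n : nat} {M : set 'rV[int]_q} {B : 'M[int]_(r, q)}.
Hypothesis SM : submonoid M.
Hypothesis M_pointed : forall x, M x -> M (- x) -> x = 0.
Hypothesis GB : lattice_basis (grp M) B.
Let m := n.+2.

(** The class in $\mathbb{Z}M/m\mathbb{Z}M\cong(\mathbb{Z}/m)^r$ with [m = n.+2], valued in a finite
    type with [m ^ r] elements. *)
Definition residue (x : 'rV[int]_q) : {ffun 'I_r -> 'I_n.+2} :=
  [ffun i => inord `|(coords (B := B) x 0%R i %% n.+2)%Z|%N].

Lemma residue_eqP x y : grp M x -> grp M y ->
  residue x = residue y <-> exists2 g, grp M g & x - y = g *+ m.
Proof.
move=> /GB.1[u ->] /GB.1[v ->]; have mE z : (z %% m)%Z = `|(z %% m)%Z|%N :> int.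
  by rewrite gez0_abs// modz_ge0.
have mulmxMn (w : 'rV[int]_r) : (w *m B) *+ m = (w *+ m) *m B.
  by rewrite -!scaler_nat scalemxAl.
have lt_m z : (`|(z %% m)%Z| < m)%N by rewrite -ltz_nat -mE ltz_pmod.
split=> [/ffunP E|[g /GB.1[w ->]]].
  exists ((\row_i ((u 0%R i - v 0%R i) %/ m)%Z) *m B).
    by apply/GB.1; exists (\row_i ((u 0%R i - v 0%R i) %/ m)%Z).
  rewrite -mulmxBl mulmxMn; congr (_ *m _); apply/rowP => i.
  rewrite mulmxnE !mxE -mulr_natr natz divzK// -eqz_mod_dvd; apply/eqP.
  have := E i; rewrite !ffunE !(coordsK GB) => /(congr1 val) /=.
  by rewrite !inordK// => /(congr1 Posz); rewrite -!mE => ->.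
rewrite -mulmxBl mulmxMn => /(basis_inj GB) E.
apply/ffunP => i; rewrite !ffunE !(coordsK GB); congr (inord `|_|%N).
apply/eqP; rewrite eqz_mod_dvd; move/rowP: E => /(_ i).
by rewrite mulmxnE !mxE => ->; rewrite -mulr_natr natz dvdz_mull.
Qed.

Lemma sub_grp x : M x -> grp M x. Proof. exact: sub_gen_smallest. Qed.

Lemma residue_inj : set_inj (Vnumerators m M) residue.
Proof.
move=> x y; rewrite !inE => -[Mx xV] [My yV] E.
have [g Gg xy] := (residue_eqP x y (sub_grp _ Mx) (sub_grp _ My)).1 E.
have [h Gh yx] := (residue_eqP y x (sub_grp _ My) (sub_grp _ Mx)).1 (esym E).
have [c Mc cE] := yV x g Mx Gg xy; have [d Md dE] := xV y h My Gh yx.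
suff -> : x = y by [].
have cd : c *+ m = - (d *+ m).
  by apply: (addrI y); rewrite -cE dE addrK.
have c0 : c *+ m = 0.
  by apply: M_pointed; last rewrite cd opprK; apply: (submonoidMn SM).
by rewrite cE c0 addr0.
Qed.

Lemma card_VsetP : (Vset m M #= `I_(m ^ rank M))%card <->
  forall k, exists2 a, Vnumerators m M a & residue a = k.
Proof.
rewrite (rankE GB) -(card_eq_injP residue_inj) card_ffun !card_ord VsetE//.
rewrite (card_eql (inj_card_eq _))// => x y _ _.
exact: scaled_inj.
Qed.

End Classes.

(** * Affine monoids and the two directions of the equivalence *)

Lemma orthant_pointed q (x : 'rV[int]_q) : @orthant q x -> @orthant q (- x) -> x = 0.
Proof.
move=> x0 nx0; apply/rowP => i; apply/eqP; rewrite mxE eq_le x0 andbT.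
by have := nx0 i; rewrite mxE oppr_ge0.
Qed.

Lemma rV_intMn_inj q m (x y : 'rV[int]_q) : (0 < m)%N -> x *+ m = y *+ m -> x = y.
Proof.
move=> m0 /rowP E; apply/rowP => i; have := E i; rewrite !mulmxnE => /eqP.
by rewrite eqr_pMn2r// => /eqP.
Qed.

Lemma rV_of_mulmx q t (h : 'I_t -> 'rV[int]_q) (c : 'I_t -> nat) :
  rV_of c *m (\matrix_i h i) = \sum_i h i *+ c i.
Proof.
rewrite mulmx_sum_row; apply: eq_bigr => i _.
by rewrite rowK mxE -natz scaler_nat.
Qed.

(** Splitting an integer vector into positive and negative parts turns an integral relation among
    the [h i] into an equality of two sums in [M]. *)
Lemma monoid_basis_lattice {q t} {M : set 'rV[int]_q} {h : 'I_t -> 'rV[int]_q} :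
  submonoid M -> monoid_basis M h -> lattice_basis (grp M) (\matrix_i h i).
Proof.
move=> SM [hM h_gen h_inj].
have sumM c : M (\sum_i h i *+ c i).
  by apply: (submonoid_sum SM) => i _; apply: (submonoidMn SM).
have posneg (u : 'rV[int]_t) : exists c e, u = rV_of c - rV_of e.
  exists (fun i => if 0 <= u 0 i then `|u 0%R i|%N else 0%N),
    (fun i => if 0 <= u 0 i then 0%N else `|u 0%R i|%N).
  by apply/rowP => i; rewrite !mxE; case: ifP => ?; lia.
split=> [x|u].
  split=> [/(grpP SM)[_ [_ [/h_gen[c ->] /h_gen[e ->] ->]]]|[u ->]].
    by exists (rV_of c - rV_of e); rewrite mulmxBl !rV_of_mulmx.
  apply/(grpP SM); have [c [e ->]] := posneg u; rewrite mulmxBl !rV_of_mulmx.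
  by exists (\sum_i h i *+ c i), (\sum_i h i *+ e i).
have [c [e ->]] := posneg u; rewrite mulmxBl !rV_of_mulmx => /eqP.
rewrite subr_eq0 => /eqP /h_inj ce; apply/eqP; rewrite subr_eq0; apply/eqP.
by apply/rowP => i; rewrite !mxE ce.
Qed.

Section AffineMonoid.
Context {q : nat} {M : set 'rV[int]_q}.
Hypothesis hM : affine_monoid M.

Let SM : submonoid M. Proof. by case: hM. Qed.
Let M_pointed x : M x -> M (- x) -> x = 0.
Proof. by case: hM => _ _ Mo /Mo x0 /Mo; apply: orthant_pointed. Qed.

(** [D x] is the quotient when [x] is written as a numerator plus [n.+2] times an element of [M]. *)
Lemma floor_map_of_residues {r n} {B : 'M[int]_(r, q)} : lattice_basis (grp M) B ->
  (forall k, exists2 a, Vnumerators n.+2 M a & residue (n := n) (B := B) a = k) ->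
  exists D, floor_map (S := M) n.+2 D.
Proof.
move=> GB res_surj.
have dec x : exists c, M x -> M c /\ Vnumerators n.+2 M (x - c *+ n.+2).
  have [Mx|nMx] := pselect (M x); last by exists 0.
  have [a aV E] := res_surj (residue (n := n) (B := B) x).
  have [Ma a_min] := aV.
  have [g Gg xa] := (residue_eqP GB _ _ (sub_grp _ Mx) (sub_grp _ Ma)).1 (esym E).
  by have [c Mc xE] := a_min x g Mx Gg xa; exists c => _; rewrite xE addrK.
have [D DE] := choice dec; exists D.
have D1 x : M x -> M (D x) by move=> /DE[].
split=> // [x /DE[_ []]//|x y Mx My].
have Mxy : M (x + y *+ n.+2) by apply: SM.2 => //; apply: (submonoidMn SM).
have [[Mc cV] [Md dV]] := (DE _ Mx, DE _ Mxy).
apply: (@rV_intMn_inj _ n.+2) => //.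
have [Mc' Md'] := (cV.1, dV.1).
(* Both remainders are numerators in the same class, hence equal by [residue_inj]. *)
suff E : x - D x *+ n.+2 = x + y *+ n.+2 - D (x + y *+ n.+2) *+ n.+2.
  move: E; rewrite -addrA => /addrI E.
  by rewrite -[LHS](subKr (y *+ n.+2)) -E opprK addrC mulrnDl.
apply: (residue_inj (n := n) SM M_pointed GB); rewrite ?mem_set//.
apply/(residue_eqP GB); try exact: sub_grp.
exists (D (x + y *+ n.+2) - y - D x); last first.
  by apply/rowP => i; rewrite !(mulmxnE, mxE); ring.
apply/(grpP SM); exists (D (x + y *+ n.+2)), (y + D x).
split; [exact: D1 | by apply: SM.2 => //; apply: D1 | by rewrite -addrA -opprD].
Qed.

Lemma monoid_basis_of_card m : (1 < m)%N -> (Vset m M #= `I_(m ^ rank M))%card ->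
  exists t (h : 'I_t -> 'rV[int]_q), monoid_basis M h.
Proof.
case: m => [|[|n]]// _; have [r [B GB]] := grp_basis hM.
move=> /(card_VsetP SM M_pointed GB)/(floor_map_of_residues GB)[D DM].
have [_ [s Ms] Mo] := hM.
(* The weight is the sum of the coordinates in absolute value, additive on the orthant. *)
apply: (floor_map_basis SM (w := fun x => (\sum_i `|x 0%R i|)%N) _ _ Ms _ DM) => //.
  move=> x _ /eqP; rewrite sum_nat_eq0 => /forallP x0.
  by apply/rowP => i; rewrite mxE; apply/eqP; rewrite -absz_eq0; apply: x0.
move=> x y /Mo x0 /Mo y0; rewrite -big_split; apply: eq_bigr => i _.
by have := x0 i; have := y0 i; rewrite mxE /=; lia.
Qed.

Lemma card_of_monoid_basis n t (h : 'I_t -> 'rV[int]_q) :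
  monoid_basis M h -> (Vset n.+2 M #= `I_(n.+2 ^ rank M))%card.
Proof.
move=> hB; have GB := monoid_basis_lattice SM hB.
apply/(card_VsetP SM M_pointed GB) => k; have [hS h_gen h_inj] := hB.
have sumM c : M (\sum_i h i *+ c i).
  by apply: (submonoid_sum SM) => i _; apply: (submonoidMn SM).
(* The representative whose multiplicities are the residues themselves, all below [n.+2]. *)
exists (\sum_i h i *+ k i).
  split=> // b g /h_gen[e ->] /GB.1[w ->] E.
  have wE i : (e i)%:Z - (k i)%:Z = w 0 i * n.+2%:Z.
    have : rV_of e - rV_of (fun i => k i : nat) = w *+ n.+2.
      apply: (basis_inj GB); rewrite mulmxBl !rV_of_mulmx E.
      by rewrite -!scaler_nat scalemxAl.
    by move=> /rowP/(_ i); rewrite mulmxnE !mxE -mulr_natr natz.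
  (* From [e i >= 0] and [k i < n.+2], the multiple [w 0 i * n.+2] exceeds [- n.+2]. *)
  have w0 i : 0 <= w 0 i.
    by have := wE i; have := ltn_ord (k i); nia.
  exists (\sum_i h i *+ `|w 0%R i|); first exact: sumM.
  rewrite -sumrMnl -big_split; apply: eq_bigr => i _ /=.
  rewrite -mulrnA -mulrnDr; congr (_ *+ _).
  by apply/eqP; rewrite -eqz_nat PoszD PoszM gez0_abs// -wE addrC subrK.
apply/ffunP => i; rewrite ffunE -rV_of_mulmx (coordsK GB) mxE.
by rewrite modz_small; [apply: inord_val | rewrite ltz_nat ltn_ord].
Qed.

End AffineMonoid.

Theorem theorem5p9 (q : nat) (hq : (0 < q)%N) (M : set 'rV[int]_q)
    (hM : affine_monoid M) :
  (exists m : nat, (1 < m)%N /\ (Vset m M #= `I_((m ^ rank M)%N))%card) <->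
  (exists t : nat, monoid_isomorphic M (@orthant t)).
Proof.
have [SM _ _] := hM.
split=> [[m [m1 /(monoid_basis_of_card hM _ m1)[t hB]]]|
         [t /(monoid_isomorphic_orthant SM)[h hB]]].
  by exists t; apply/(monoid_isomorphic_orthant SM).
by exists 2%N; split=> //; apply: card_of_monoid_basis hB.
Qed.
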